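(* Let $(\mathfrak g,[-,-],R)$ be a Rota-Baxter Lie algebra of weight $1$ over $\mathbf k$, let $\mathfrak g^{(p)}=\mathrm{span}_{\mathbf k}\{x^{p^k}\in\mathrm U(\mathfrak g)\mid x\in\mathfrak g,\ k\ge0\}$ be the Lie algebra of primitive elements of $\mathrm U(\mathfrak g)$, and let $R$ also denote the restriction to $\mathfrak g^{(p)}$ of the extension of $R$ to $\mathrm U(\mathfrak g)$, so that $(\mathfrak g^{(p)},[-,-],(-)^p,R)$ is a restricted Rota-Baxter Lie algebra of weight $1$. Then for all $x\in\mathfrak g^{(p)}$, $$R(x^p)=R(x)^p+\sum_{r=1}^{p-1}(-1)^{p-r}\frac1r\sum_{\alpha\vDash p,\ \ell(\alpha)=r}C_\alpha\,[R(x^{\blacktriangleright_R\alpha_1}),[\cdots[R(x^{\blacktriangleright_R\alpha_{r-1}}),R(x^{\blacktriangleright_R\alpha_r})]\cdots]],$$ where $x^{\blacktriangleright_Rk}$ is the sum of all $(k-1)!$ iterated products of $k$ copies of $x$ (counting multiplicities) with respect to $x\rhd_Ry:=[R(x),y]$.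
   Context: Convention: $\mathbf k$ is an algebraically closed field of prime characteristic $p$; everything is over $\mathbf k$. Rota-Baxter Lie algebra of weight $1$: a Lie algebra with a linear map $R$ such that $[R(x),R(y)]=R([R(x),y])+R([x,R(y)])+R([x,y])$ for all $x,y$. Extension to $\mathrm U(\mathfrak g)$ (Goncharov): a Rota-Baxter operator $R$ of weight $1$ on $\mathfrak g$ extends to a well-defined linear map $R:\mathrm U(\mathfrak g)\to\mathrm U(\mathfrak g)$ determined by $R(1)=1$ and $R(xy)=R(x)R(y)-R([R(x),y])$ for $x\in\mathfrak g$, $y\in\mathrm U(\mathfrak g)$ (commutator in $\mathrm U(\mathfrak g)$). It is a coalgebra endomorphism (elements of $\mathfrak g$ primitive), hence preserves $\mathfrak g^{(p)}$, and satisfies $R(x)R(y)=R(x_1R(x_2)\,y\,S(R(x_3)))$ for all $x,y\in\mathrm U(\mathfrak g)$ (Sweedler notation, $S$ the antipode). Brackets and $p$-th powers are taken in $\mathrm U(\mathfrak g)$. For a composition $\alpha=(\alpha_1,\dots,\alpha_r)\vDash n$ (a tuple of positive integers with sum $n$, of length $\ell(\alpha)=r$), $C_\alpha=\prod_{k=1}^r\binom{\alpha_1+\cdots+\alpha_k-1}{\alpha_k-1}$. $\frac1r$ is the inverse of $r$ modulo $p$; for $r=1$ the iterated bracket is just $R(x^{\blacktriangleright_R p})$. The multiplicities in $x^{\blacktriangleright_Rk}$ are given by the recursion $x^{\blacktriangleright_R1}=x$ and $x^{\blacktriangleright_Rk}=\sum_{i=1}^{k-1}\binom{k-2}{i-1}\,x^{\blacktriangleright_Ri}\rhd_Rx^{\blacktriangleright_R(k-i)}$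 for $k\ge2$; e.g. (writing $\rhd$ for $\rhd_R$) $x^{\blacktriangleright_R4}=x\rhd(x\rhd(x\rhd x))+x\rhd((x\rhd x)\rhd x)+2(x\rhd x)\rhd(x\rhd x)+(x\rhd(x\rhd x))\rhd x+((x\rhd x)\rhd x)\rhd x$. *)

(* Defs.v *)
From HB Require Import structures.
From mathcomp Require Import all_boot all_order all_algebra.

Set Implicit Arguments.
Unset Strict Implicit.
Unset Printing Implicit Defensive.

Import GRing.Theory.
Local Open Scope ring_scope.

HB.mixin Record Lmodule_isLieAlgebra (k : fieldType) g
    of GRing.Lmodule k g := {
  lie_br : g -> g -> g;
  lie_br_linearl : forall y : g, linear (fun x : g => lie_br x y);
  lie_br_linearr : forall x : g, linear (lie_br x);
  lie_br_alt : forall x : g, lie_br x x = 0;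
  lie_br_jacobi : forall x y z : g,
    lie_br x (lie_br y z) + lie_br y (lie_br z x) + lie_br z (lie_br x y) = 0
}.

#[short(type="lieAlgType")]
HB.structure Definition LieAlgebra (k : fieldType) :=
  {g of GRing.Lmodule k g & Lmodule_isLieAlgebra k g}.

Definition rota_baxter1 (k : fieldType) (g : lieAlgType k)
    (R : {linear g -> g}) : Prop :=
  forall x y : g, lie_br (R x) (R y) =
    R (lie_br (R x) y) + R (lie_br x (R y)) + R (lie_br x y).

Definition comm_br (A : pzRingType) (x y : A) : A := x * y - y * x.

Definition lie_to_assoc (k : fieldType) (g : lieAlgType k) (A : algType k)
    (f : {linear g -> A}) : Prop :=
  forall x y : g, f (lie_br x y) = comm_br (f x) (f y).

(* U(g) is specified, up to unique isomorphism, by its universal property. *)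
Definition enveloping_algebra (k : fieldType) (g : lieAlgType k)
    (U : algType k) (iota : {linear g -> U}) : Prop :=
  lie_to_assoc iota /\
  forall (A : algType k) (f : {linear g -> A}), lie_to_assoc f ->
    exists F : {lrmorphism U -> A},
      (forall x : g, F (iota x) = f x) /\
      (forall G : {lrmorphism U -> A},
         (forall x : g, G (iota x) = f x) -> forall u : U, G u = F u).

(* Goncharov's extension; U is generated by the image of iota, so at most one
   RU satisfies this. *)
Definition rb_extension (k : fieldType) (g : lieAlgType k) (U : algType k)
    (iota : {linear g -> U}) (R : {linear g -> g}) (RU : {linear U -> U})
    : Prop :=
  [/\ forall x : g, RU (iota x) = iota (R x),
      RU 1 = 1
    & forall (x : g) (y : U), RU (iota x * y) =
        RU (iota x) * RU y - RU (comm_br (RU (iota x)) y)].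

(* Linear span of a possibly infinite set of vectors. *)
Definition in_span (k : fieldType) (V : lmodType k) (S : V -> Prop) (u : V)
    : Prop :=
  exists (n : nat) (c : 'I_n -> k) (v : 'I_n -> V),
    (forall i : 'I_n, S (v i)) /\ u = \sum_(i < n) c i *: v i.

Definition in_gp (p : nat) (k : fieldType) (g : lieAlgType k) (U : algType k)
    (iota : {linear g -> U}) : U -> Prop :=
  in_span (fun u : U => exists (x : g) (n : nat), u = iota x ^+ (p ^ n)).

Definition rb_tri (k : fieldType) (U : algType k) (R : {linear U -> U})
    (x y : U) : U := comm_br (R x) y.

(* tri_seq op x n lists the first n iterated powers of x for the product op;
   the k-th power is the entry of index k.-1. See tri_pow1 and tri_powE. *)
Fixpoint tri_seq (V : zmodType) (op : V -> V -> V) (x : V) (n : nat) : seq V :=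
  if n is m.+1 then
    let s := tri_seq op x m in
    rcons s (if m is 0%N then x else
      \sum_(1 <= i < m.+1) op s`_(i.-1) s`_((m.+1 - i).-1) *+ 'C(m.-1, i.-1))
  else [::].

Definition tri_pow (V : zmodType) (op : V -> V -> V) (x : V) (n : nat) : V :=
  (tri_seq op x n)`_(n.-1).

Lemma size_tri_seq (V : zmodType) (op : V -> V -> V) (x : V) (n : nat) :
  size (tri_seq op x n) = n.
Proof. by elim: n => //= n IHn; rewrite size_rcons IHn. Qed.

Lemma nth_tri_seq (V : zmodType) (op : V -> V -> V) (x : V) (n i : nat) :
  (i < n)%N -> (tri_seq op x n)`_i = tri_pow op x i.+1.
Proof.
elim: n => // n IHn; rewrite ltnS leq_eqVlt => /orP[/eqP -> //|lt_in].
by rewrite [tri_seq]lock /= -lock /= nth_rcons size_tri_seq lt_in IHn.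
Qed.

Lemma tri_pow1 (V : zmodType) (op : V -> V -> V) (x : V) :
  tri_pow op x 1 = x.
Proof. by []. Qed.

Lemma tri_powE (V : zmodType) (op : V -> V -> V) (x : V) (n : nat) :
  (2 <= n)%N ->
  tri_pow op x n =
    \sum_(1 <= i < n)
      op (tri_pow op x i) (tri_pow op x (n - i)) *+ 'C(n - 2, i - 1).
Proof.
case: n => [|[|m]] // _.
rewrite {1}/tri_pow; set t := tri_seq op x m.+1.
have -> : tri_seq op x m.+2 = rcons t
   (\sum_(1 <= i < m.+2) op t`_(i.-1) t`_((m.+2 - i).-1) *+ 'C(m, i.-1)) by [].
rewrite nth_rcons size_tri_seq ltnn eqxx subn2.
apply: eq_big_nat => -[|i] // /andP[_ lt_i]; rewrite subn1 /=.
have lt_i' : (i < m.+1)%N by [].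
rewrite nth_tri_seq // subSS nth_tri_seq; last first.
  by rewrite -ltnS prednK ?subn_gt0 // ltnS leq_subr.
by rewrite prednK ?subn_gt0.
Qed.

(* Parts of a composition of n are at most n, so the compositions of n of
   length r are found among the r-tuples over 'I_n.+1. *)
Definition is_composition (n : nat) (a : seq nat) : bool :=
  all (fun m => 0 < m)%N a && (sumn a == n).

Definition comp_coef (a : seq nat) : nat :=
  (\prod_(k < size a) 'C((sumn (take k.+1 a)).-1, (nth 0 a k).-1))%N.

(* right_br [:: a1; ...; ar] = [a1, [... [a(r-1), ar] ...]] *)
Fixpoint right_br (A : pzRingType) (s : seq A) : A :=
  match s with
  | [::] => 0
  | [:: a] => a
  | a :: s' => comm_br a (right_br s')
  end.

(* Main.v *)
(* A sequence f stands for the divided-power series \sum_n f_n s^n / n!, so that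
   shifting is d/ds and the product is binomial convolution; this makes sense in
   characteristic p.  Put X_n = (-1)^n x^{|> n+1} and A = R(X).  The recursion
   for x^{|> n} says X' = -[A, X].  Let F' = F A and F(0) = 1.  Then
   F X F^-1 = x, and u |-> F R(u) and u |-> R(e^{sx} F u F^-1) solve the same
   linear equation, so they agree; at u = 1 this gives R(x^n) = F_n.
   On the other hand, grading F by the number of factors A, the Dynkin operator
   turns F into D with D' = F A F^-1, and the Euler operator satisfies
   Y(F) = D F.  At n = p the binomial coefficients kill the mixed terms: r times
   the part of degree r of F_p is its image under right bracketing.
   All this needs R(y) R(u) = R(y u + [R(y), u]) for y = X_n.  It holds on g, the
   comparison at n = p transports it from x to x^p, and X_n lies in g for
   n >= 1 because [g^(p), g^(p)] is contained in g. *)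
Require Import Defs.
From HB Require Import structures.
From mathcomp Require Import all_boot all_order all_algebra.

Set Implicit Arguments.
Unset Strict Implicit.
Unset Printing Implicit Defensive.

Import GRing.Theory.
Local Open Scope ring_scope.

Definition hconv (T1 T2 : Type) (V : zmodType) (op : T1 -> T2 -> V)
    (f : nat -> T1) (g : nat -> T2) (n : nat) : V :=
  \sum_(i < n.+1) op (f i) (g (n - i)%N) *+ 'C(n, i).

Lemma hconv0 (T1 T2 : Type) (V : zmodType) (op : T1 -> T2 -> V) f g :
  hconv op f g 0 = op (f 0%N) (g 0%N).
Proof. by rewrite /hconv big_ord1. Qed.

Lemma hconvS (T1 T2 : Type) (V : zmodType) (op : T1 -> T2 -> V) f g n :
  hconv op f g n.+1 =
    hconv op (fun i => f i.+1) g n + hconv op f (fun i => g i.+1) n.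
Proof.
rewrite /hconv big_ord_recl bin0 subn0.
under eq_bigr => i _ do rewrite lift0 subSS binS mulrnDr.
rewrite big_split /= addrA addrC; congr (_ + _).
rewrite [RHS]big_ord_recl bin0 subn0; congr (_ + _).
rewrite big_ord_recr /= bin_small ?mulr0n ?addr0 //.
by apply: eq_bigr => i _; rewrite /= /bump leq0n add1n subnSK.
Qed.

Lemma eq_hconv (T1 T2 : Type) (V : zmodType) (op op' : T1 -> T2 -> V)
    f f' g g' n :
  (forall a b, op a b = op' a b) ->
  (forall i, (i <= n)%N -> f i = f' i) -> (forall i, (i <= n)%N -> g i = g' i) ->
  hconv op f g n = hconv op' f' g' n.
Proof.
move=> eq_op eq_f eq_g; apply: eq_bigr => i _.
by rewrite eq_op eq_f ?eq_g ?leq_subr // -ltnS ltn_ord.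
Qed.

Lemma hconvC (T1 T2 : Type) (V : zmodType) (op : T1 -> T2 -> V) f g n :
  hconv op f g n = hconv (fun b a => op a b) g f n.
Proof.
rewrite /hconv (reindex_inj rev_ord_inj) /=; apply: eq_bigr => i _.
by rewrite subSS subKn ?bin_sub // -ltnS ltn_ord.
Qed.

Lemma hconv_pchar (T1 T2 : Type) (V : zmodType) (op : T1 -> T2 -> V) f g p :
  prime p -> (forall v : V, v *+ p = 0) ->
  hconv op f g p = op (f 0%N) (g p) + op (f p) (g 0%N).
Proof.
move=> pr_p Vp; case: p pr_p Vp => // p pr_p Vp.
rewrite /hconv big_ord_recl big_ord_recr /= bin0 subn0 big1 ?add0r.
  by rewrite /bump leq0n add1n binn subnn !mulr1n.
move=> i _; rewrite /bump leq0n add1n.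
have /dvdnP[q ->] : (p.+1 %| 'C(p.+1, i.+1))%N.
  by apply: prime_dvd_bin => //; exact: (ltn_ord i).
by rewrite mulnC mulrnA Vp mul0rn.
Qed.

Lemma hconv_exists (T : Type) (V : zmodType) (op : V -> T -> V) (v : V) (A : nat -> T) :
  exists2 F : nat -> V, F 0%N = v & forall n, F n.+1 = hconv op F A n.
Proof.
pose P := fix P m : nat -> V := if m is m'.+1 then
  fun n => (if n is n'.+1 then hconv op (P m') A n' else v) else fun=> v.
have stab m m' n : (n <= m)%N -> (n <= m')%N -> P m n = P m' n.
  elim: m m' n => [|m IHm] [|m'] [|n] //= le_nm le_nm'.
  apply: eq_hconv => // i le_in.
  by apply: IHm; apply: leq_trans le_in _.
exists (fun n => P n n) => // n; apply: eq_hconv => // i le_in.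
exact: stab.
Qed.

Section Ring.
Variable B : pzRingType.
Implicit Types (f g h : nat -> B) (a u : B).

Local Notation "f ** g" := (hconv *%R f g) (at level 40, left associativity).

Lemma hmulDl f f' g n : ((fun i => f i + f' i) ** g) n = (f ** g) n + (f' ** g) n.
Proof.
by rewrite -big_split; apply: eq_bigr => i _; rewrite mulrDl mulrnDl.
Qed.

Lemma hmulDr f g g' n : (f ** (fun i => g i + g' i)) n = (f ** g) n + (f ** g') n.
Proof.
by rewrite -big_split; apply: eq_bigr => i _; rewrite mulrDr mulrnDl.
Qed.

Lemma hmulNl f g n : ((fun i => - f i) ** g) n = - (f ** g) n.
Proof.
by rewrite -sumrN; apply: eq_bigr => i _; rewrite mulNr mulNrn.
Qed.

Lemma hmulNr f g n : (f ** (fun i => - g i)) n = - (f ** g) n.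
Proof.
by rewrite -sumrN; apply: eq_bigr => i _; rewrite mulrN mulNrn.
Qed.

Lemma hmulMl a f g n : ((fun i => a * f i) ** g) n = a * (f ** g) n.
Proof.
by rewrite mulr_sumr; apply: eq_bigr => i _; rewrite -mulrA mulrnAr.
Qed.

Lemma hmulMr a f g n : (f ** (fun i => g i * a)) n = (f ** g) n * a.
Proof.
by rewrite mulr_suml; apply: eq_bigr => i _; rewrite mulrA mulrnAl.
Qed.

Lemma hmulMm a f g n : ((fun i => f i * a) ** g) n = (f ** (fun i => a * g i)) n.
Proof. by apply: eq_bigr => i _; rewrite mulrA. Qed.

Lemma hmulA f g h : f ** (g ** h) =1 f ** g ** h.
Proof.
move=> n; elim: n f g h => [|n IHn] f g h; first by rewrite !hconv0 mulrA.
rewrite !hconvS IHn.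
rewrite [X in _ + X = _](eq_hconv (op' := *%R) (f' := f)
  (g' := fun i => ((fun j => g j.+1) ** h) i + (g ** (fun j => h j.+1)) i)) //;
  last by move=> i _; rewrite hconvS.
rewrite [X in _ = X + _](eq_hconv (op' := *%R) (g' := h)
  (f' := fun i => ((fun j => f j.+1) ** g) i + (f ** (fun j => g j.+1)) i)) //;
  last by move=> i _; rewrite hconvS.
by rewrite hmulDl hmulDr !IHn addrA.
Qed.

End Ring.

Section LinearODE.
Variable B : pzRingType.
Implicit Types (f g A F E P Q Z V : nat -> B) (a u x : B).

Local Notation "f ** g" := (hconv *%R f g) (at level 40, left associativity).

Lemma linear_ode_uniq A V Z Z' :
  Z 0%N = Z' 0%N ->
  (forall n, Z n.+1 = (Z ** A) n + V n) ->
  (forall n, Z' n.+1 = (Z' ** A) n + V n) -> Z =1 Z'.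
Proof.
move=> eq0 eqS eqS' n; elim/ltn_ind: n => -[|n] IHn //.
by rewrite eqS eqS'; congr (_ + _); apply: eq_hconv.
Qed.

Lemma left_ode_exists A :
  exists2 E, E 0%N = 1 & forall n, E n.+1 = - (A ** E) n.
Proof.
have [E E0 ES] := hconv_exists (fun e a => - (a * e)) (1 : B) A.
exists E => // n; rewrite ES hconvC -hmulNl.
by apply: eq_bigr => i _; rewrite mulNr.
Qed.

Lemma hmul1s f n : ((fun i => (i == 0)%:R) ** f) n = f n.
Proof.
rewrite /hconv big_ord_recl bin0 subn0 mul1r big1 ?addr0 // => i _.
by rewrite mul0r mul0rn.
Qed.

Lemma hmuls1 f n : (f ** (fun i => (i == 0)%:R)) n = f n.
Proof.
rewrite hconvC /hconv big_ord_recl bin0 subn0 mulr1 big1 ?addr0 // => i _.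
by rewrite mulr0 mul0rn.
Qed.

Lemma ode_invr A F E :
  F 0%N = 1 -> (forall n, F n.+1 = (F ** A) n) ->
  E 0%N = 1 -> (forall n, E n.+1 = - (A ** E) n) ->
  forall n, (F ** E) n = (n == 0)%:R.
Proof.
move=> F0 FS E0 ES [|n]; first by rewrite hconv0 F0 E0 mul1r.
rewrite hconvS (eq_hconv (op' := *%R) (f' := F ** A) (g' := E)) //.
rewrite [X in _ + X](eq_hconv (op' := *%R) (f' := F)
  (g' := fun i => - (A ** E) i)) //.
by rewrite hmulNr hmulA subrr.
Qed.

Lemma ode_invl A F E :
  F 0%N = 1 -> (forall n, F n.+1 = (F ** A) n) ->
  E 0%N = 1 -> (forall n, E n.+1 = - (A ** E) n) ->
  forall n, (E ** F) n = (n == 0)%:R.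
Proof.
move=> F0 FS E0 ES n; elim/ltn_ind: n => -[|n] IHn.
  by rewrite hconv0 F0 E0 mul1r.
have EF i : (i <= n)%N -> (E ** F) i = (i == 0)%:R by move=> ?; apply: IHn.
rewrite hconvS addrC.
rewrite (eq_hconv (op' := *%R) (f' := E) (g' := F ** A)) //.
rewrite [X in _ + X](eq_hconv (op' := *%R) (g' := F)
  (f' := fun i => - (A ** E) i)) // hmulNl hmulA -[X in _ - X]hmulA.
rewrite (eq_hconv (op' := *%R) (f := E ** F) (g' := A)
  (f' := fun i => (i == 0)%:R)) //.
rewrite [X in _ - X](eq_hconv (op' := *%R) (f' := A) (g := E ** F)
  (g' := fun i => (i == 0)%:R)) //.
by rewrite hmul1s hmuls1 subrr.
Qed.

Definition sandwich P Q u : nat -> B := hconv (fun a b => a * u * b) P Q.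

Lemma sandwichE P Q u n : sandwich P Q u n = (P ** (fun i => u * Q i)) n.
Proof. by apply: eq_bigr => i _; rewrite mulrA. Qed.

Lemma hmul_sandwich P f Q n :
  ((P ** f) ** Q) n = \sum_(j < n.+1) sandwich P Q (f j) (n - j)%N *+ 'C(n, j).
Proof.
transitivity (hconv (fun b (w : B -> B) => w b) f
  (fun m b => sandwich P Q b m) n); last by [].
elim: n P f Q => [|n IHn] P f Q; first by rewrite !hconv0 /sandwich hconv0.
rewrite !hconvS.
rewrite (eq_hconv (op' := *%R) (g' := Q) (f' := fun i =>
  ((fun j => P j.+1) ** f) i + (P ** (fun j => f j.+1)) i)) //;
  last by move=> i _; rewrite hconvS.
rewrite hmulDl !IHn addrAC addrC; congr (_ + _).
rewrite -big_split; apply: eq_bigr => i _ /=.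
by rewrite -mulrnDl /sandwich hconvS.
Qed.

Lemma sandwichS P Q f g u n :
  (forall n, P n.+1 = (P ** f) n) -> (forall n, Q n.+1 = - (g ** Q) n) ->
  sandwich P Q u n.+1 =
    \sum_(j < n.+1) sandwich P Q (f j * u - u * g j) (n - j)%N *+ 'C(n, j).
Proof.
move=> PS QS; rewrite sandwichE hconvS.
rewrite (eq_hconv (op' := *%R) (f' := P ** f) (g' := fun i => u * Q i)) //.
rewrite [X in _ + X](eq_hconv (op' := *%R) (f' := fun i => P i)
  (g' := fun i => - ((fun j => u * g j) ** Q) i)) //; last first.
  by move=> i _; rewrite QS mulrN hmulMl.
rewrite hmulNr hmulA !hmul_sandwich -sumrB; apply: eq_bigr => j _.
rewrite -mulrnBl !sandwichE; congr (_ *+ _).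
rewrite -hmulNr -hmulDr; apply: eq_bigr => i _.
by rewrite mulrBl !mulrA.
Qed.

End LinearODE.

(* [F] behaves like a time-ordered exponential, so [delta F * F^-1] is the
   Dynkin image [D] of [F], with [D' = F A F^-1]; the coefficient at [p] of
   [delta F = D F] loses all its mixed terms. *)
Lemma dynkin_ode (B : pzRingType) (delta : {additive B -> B}) (A F E : nat -> B)
    (p : nat) :
  (forall a b, delta (a * b) = delta a * b + a * delta b) ->
  (forall n, delta (A n) = A n) ->
  F 0%N = 1 -> (forall n, F n.+1 = hconv *%R F A n) ->
  E 0%N = 1 -> (forall n, E n.+1 = - hconv *%R A E n) ->
  prime p -> (forall b : B, b *+ p = 0) ->
  delta (F p) =
    \sum_(j < p) sandwich F E (A j) (p.-1 - j)%N *+ 'C(p.-1, j).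
Proof.
move=> deltaM deltaA F0 FS E0 ES pr_p Bp.
have delta1 : delta 1 = 0.
  by apply: (@addrI _ (delta 1)); rewrite addr0 -{3}(mulr1 1) deltaM mulr1 mul1r.
pose L n := if n is m.+1 then hconv *%R (hconv *%R F A) E m else 0.
have deltaF : delta \o F =1 hconv *%R L F.
  apply: (@linear_ode_uniq _ A (hconv *%R F A)) => [|n|n] /=.
  - by rewrite hconv0 F0 delta1 mul0r.
  - rewrite FS raddf_sum -big_split; apply: eq_bigr => i _ /=.
    by rewrite raddfMn deltaM deltaA mulrnDl.
  rewrite hconvS addrC; congr (_ + _).
    by rewrite (eq_hconv (op' := *%R) (f' := L) (g' := hconv *%R F A)) // hmulA.
  rewrite (eq_hconv (op' := *%R) (g' := F)
    (f' := hconv *%R (hconv *%R F A) E)) // -hmulA.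
  rewrite (eq_hconv (op' := *%R) (f' := hconv *%R F A)
    (g' := fun i => (i == 0)%:R)) // ?hmuls1 // => i _.
  exact: ode_invl.
rewrite -[LHS]/((delta \o F) p) deltaF hconv_pchar // F0 mulr1 mul0r add0r.
by case: p pr_p {Bp} => // p _; rewrite /L hmul_sandwich.
Qed.

Section CompositionSum.
Variables (V : zmodType) (N : nat).
Implicit Types (G : seq nat -> V) (n r : nat).

Definition comp_sum n r G : V :=
  \sum_(a : r.-tuple 'I_N.+1 | is_composition n (map val a))
    G (map val a) *+ comp_coef (map val a).

Lemma comp_coef_rcons b m :
  comp_coef (rcons b m) = (comp_coef b * 'C((sumn b + m).-1, m.-1))%N.
Proof.
rewrite /comp_coef size_rcons big_ord_recr /=; congr (_ * _)%N.
  apply: eq_bigr => i _; rewrite nth_rcons ltn_ord -cats1 takel_cat //.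
rewrite nth_rcons ltnn eqxx -(size_rcons b m) take_size sumn_rcons.
by [].
Qed.

Lemma comp_sum0r n G : comp_sum n 0 G = G [::] *+ (n == 0)%N.
Proof.
rewrite /comp_sum; case: eqP => [->|/eqP n0].
  rewrite (big_pred1 [tuple]) => [|a]; last by rewrite tuple0; apply/esym/eqP.
  by rewrite /comp_coef big_ord0.
by apply: big_pred0 => a; rewrite tuple0 /is_composition /= eq_sym (negPf n0).
Qed.

Lemma comp_sum0S r G : comp_sum 0 r.+1 G = 0.
Proof.
apply: big_pred0 => a; case/tupleP: a => i a /=.
by rewrite /is_composition /=; case: (val i) => // m; rewrite addSn andbF.
Qed.

Lemma eq_comp_sum n r G G' : G =1 G' -> comp_sum n r G = comp_sum n r G'.
Proof. by move=> eqG; apply: eq_bigr => a _; rewrite eqG. Qed.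

Lemma comp_sumSS n r G : (n < N)%N ->
  comp_sum n.+1 r.+1 G =
    \sum_(j < n.+1) comp_sum (n - j)%N r (fun b => G (rcons b j.+1)) *+ 'C(n, j).
Proof.
move=> lt_nN.
pose h (u : 'I_N.+1 * r.-tuple 'I_N.+1) := [tuple of rcons u.2 u.1].
pose h' (t : r.+1.-tuple 'I_N.+1) :=
  (last ord0 t, [tuple of belast (head ord0 t) (behead t)]).
rewrite /comp_sum (reindex h) /=; last first.
  exists h' => [[i b] _|t _].
    rewrite /h' /h /=; congr (_, _); first by rewrite last_rcons.
    apply: val_inj => /=.
    by case: (tval b) => //= x s; rewrite belast_rcons.
  by apply: val_inj; case/tupleP: t => x s /=; rewrite -lastI.
pose comp_pred i (b : r.-tuple 'I_N.+1) := is_composition (n.+1 - i)%N (map val b).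
rewrite (eq_bigl (fun u : 'I_N.+1 * r.-tuple 'I_N.+1 => (0 < u.1 <= n.+1)%N &&
   comp_pred u.1 u.2)); last first.
  move=> [i b]; rewrite /comp_pred /is_composition /h /= map_rcons all_rcons.
  rewrite sumn_rcons /= -!andbA; congr (_ && _).
  case: leqP => [le_in|lt_ni]; first by rewrite -[in LHS](subnK le_in) eqn_add2r.
  apply/negbTE; rewrite negb_and; apply/orP; right; rewrite neq_ltn.
  by rewrite (leq_trans lt_ni) ?leq_addl ?orbT.
rewrite -(pair_big_dep (fun i : 'I_N.+1 => 0 < i <= n.+1)%N comp_pred
  (fun i b => G (map val (h (i, b))) *+ comp_coef (map val (h (i, b))))) /=.
rewrite big_mkcond big_ord_recl /= add0r -big_mkcond /=.
rewrite [RHS](big_ord_widen N (fun j => comp_sum (n - j) r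
  (fun b => G (rcons b j.+1)) *+ 'C(n, j)))//.
apply: eq_big => [j|j le_jn]; first by rewrite /bump leq0n add1n.
rewrite /comp_sum -sumrMnl; apply: eq_big => [b|b].
  by rewrite /comp_pred /bump leq0n add1n subSS.
rewrite /comp_pred /is_composition => /andP[_ /eqP sum_b].
rewrite map_rcons comp_coef_rcons sum_b /= /bump leq0n add1n.
by rewrite subnK //= mulrnA.
Qed.
End CompositionSum.

Lemma right_br_rcons (A : pzRingType) (s : seq A) (u : A) :
  right_br (rcons s u) = foldr (@comm_br A) u s.
Proof. by elim: s => [|a s IHs] //=; rewrite -IHs; case: s {IHs}. Qed.

Lemma hmul_poly_ind (B : nzRingType) (a : nat -> B) (F : nat -> {poly B}) n r :
  (forall n, F n.+1 = hconv *%R F (fun i => 'X * (a i)%:P) n) ->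
  (F n.+1)`_r.+1 = \sum_(i < n.+1) (F i)`_r * a (n - i)%N *+ 'C(n, i).
Proof.
move=> FS; rewrite FS /hconv coef_sum; apply: eq_bigr => i _.
by rewrite coefMn mulrA coefMC commr_polyX coefXM.
Qed.

Theorem pchar_ode_dynkin (k : fieldType) (U : algType k) (p : nat)
    (a F : nat -> U) :
  p \in [pchar k] -> F 0%N = 1 -> (forall n, F n.+1 = hconv *%R F a n) ->
  F p = a 0%N ^+ p + \sum_(1 <= r < p) ((r%:R)^-1 : k) *:
    comp_sum p p r (fun s => right_br [seq a i.-1 | i <- s]).
Proof.
move=> hp F0 FS; have pr_p : prime p := pcharf_prime hp.
have Up (v : U) : v *+ p = 0 by rewrite -scaler_nat pcharf0 ?scale0r.
have UXp (v : {poly U}) : v *+ p = 0 by apply/polyP=> i; rewrite coefMn Up coef0.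
pose A i : {poly U} := 'X * (a i)%:P.
have [H H0 HS] := hconv_exists *%R (1 : {poly U}) A.
have [E E0 ES] := left_ode_exists A.
have FE : (fun n => (H n).[1]) =1 F.
  apply: (@linear_ode_uniq _ a (fun=> 0)) => [|n|n]; rewrite ?addr0 ?FS //.
    by rewrite H0 hornerC F0.
  rewrite HS /hconv horner_sum; apply: eq_bigr => i _.
  rewrite hornerMn hornerM_comm; last by rewrite /comm_poly mulr1 mul1r.
  by rewrite /A -commr_polyX hornerMX hornerC mulr1.
have H0r n : (H n.+1)`_0 = 0.
  rewrite HS coef_sum big1 // => i _.
  by rewrite coefMn mulrA coefMC commr_polyX coefXM mul0r mul0rn.
have Hhi n r : (n < r)%N -> (H n)`_r = 0.
  elim/ltn_ind: n r => -[|n] IHn [|r] // lt_nr; first by rewrite H0 coefC.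
  rewrite (hmul_poly_ind _ _ HS) big1 // => i _.
  by rewrite IHn ?mul0r ?mul0rn //; apply: leq_trans (ltn_ord i) lt_nr.
have Hn n : (H n)`_n = a 0%N ^+ n.
  elim: n => [|n IHn]; first by rewrite H0 coefC.
  rewrite (hmul_poly_ind _ _ HS) big_ord_recr /= subnn binn mulr1n IHn exprSr.
  rewrite big1 ?add0r // => i _.
  by rewrite Hhi ?mul0r ?mul0rn.
have sandwichX b n : sandwich H E ('X * b) n = 'X * sandwich H E b n.
  rewrite mulr_sumr; apply: eq_bigr => i _.
  by rewrite mulrnAr !mulrA commr_polyX.
have A_comm j u : A j * u%:P - u%:P * A j = 'X * (comm_br (a j) u)%:P.
  by rewrite /A /comm_br polyCB !polyCM mulrBr !mulrA commr_polyX.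
have coef_sandwich r n u : (n <= p)%N ->
    (sandwich H E u%:P n)`_r =
      comp_sum p n r (fun s => foldr (@comm_br U) u [seq a i.-1 | i <- s]).
  elim: r n u => [|r IHr] [|n] u le_np.
  - by rewrite comp_sum0r /sandwich hconv0 H0 E0 mul1r mulr1 coefC.
  - rewrite comp_sum0r (sandwichS _ _ HS ES) coef_sum big1 // => j _.
    by rewrite coefMn A_comm sandwichX coefXM mul0rn.
  - by rewrite comp_sum0S /sandwich hconv0 H0 E0 mul1r mulr1 coefC.
  rewrite comp_sumSS // (sandwichS _ _ HS ES) coef_sum; apply: eq_bigr => j _.
  rewrite coefMn A_comm sandwichX coefXM /= IHr; last
    by rewrite (leq_trans (leq_subr _ _)) // ltnW.
  congr (_ *+ _); apply: eq_comp_sum => s.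
  by rewrite map_rcons foldr_rcons.
pose delta (f : {poly U}) := 'X * f^`().
have delta_additive : additive delta.
  by move=> f f'; rewrite /delta derivB mulrBr.
pose deltaH := GRing.isAdditive.Build _ _ delta delta_additive.
pose D : {additive {poly U} -> {poly U}} := HB.pack delta deltaH.
have Hr r : (0 < r)%N -> (H p)`_r *+ r =
    comp_sum p p r (fun s => right_br [seq a i.-1 | i <- s]).
  case: r => // r _.
  have deltaHp : D (H p) =
      \sum_(j < p) sandwich H E (A j) (p.-1 - j)%N *+ 'C(p.-1, j).
    apply: (@dynkin_ode _ D A H E p) => //= [f f'|i].
      by rewrite /delta derivM mulrDr !mulrA commr_polyX.
    by rewrite /delta /A derivM derivX derivC mulr0 addr0 mul1r.
  have := congr1 (fun f : {poly U} => f`_r.+1) deltaHp.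
  rewrite /= /delta coefXM /= coef_deriv => ->.
  case: (p) pr_p coef_sandwich => // q _ coef_sandwich.
  rewrite comp_sumSS // coef_sum; apply: eq_bigr => j _.
  rewrite coefMn sandwichX coefXM /= coef_sandwich; last
    by rewrite (leq_trans (leq_subr _ _)).
  congr (_ *+ _); apply: eq_comp_sum => s.
  by rewrite map_rcons right_br_rcons.
rewrite -FE (horner_coef_wide (n := p.+1)); last first.
  by apply/leq_sizeP => j; exact: Hhi.
rewrite big_ord_recr /= expr1n mulr1 Hn addrC; congr (_ + _).
case: (p) pr_p Hr hp H0r => // q pr_q Hr hq H0r.
rewrite -(big_mkord xpredT (fun i => (H q.+1)`_i * 1 ^+ i)) big_ltn // H0r mul0r.
rewrite add0r; apply: eq_big_nat => r /andP[r_gt0 lt_rq].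
rewrite expr1n mulr1 -Hr // -scaler_nat scalerA mulVf ?scale1r //.
by rewrite -(dvdn_pcharf hq) gtnNdvd.
Qed.

Lemma hconv_comm_br (A : pzRingType) (f g : nat -> A) n :
  hconv (@comm_br A) f g n = hconv *%R f g n - hconv *%R g f n.
Proof.
rewrite [X in _ - X]hconvC -sumrB; apply: eq_bigr => i _.
by rewrite -mulrnBl.
Qed.

Section RotaBaxterSeries.
Variables (k : fieldType) (U : algType k) (R : {linear U -> U}).

(* Goncharov's identity with [x] not restricted to the image of [g]. *)
Definition rb_star (x : U) : Prop :=
  forall u : U, R x * R u = R (x * u + comm_br (R x) u).

Definition tri_ser (x : U) (n : nat) : U :=
  (-1) ^+ n *: tri_pow (rb_tri R) x n.+1.

Lemma tri_serS x n :
  tri_ser x n.+1 = - hconv (@comm_br U) (R \o tri_ser x) (tri_ser x) n.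
Proof.
rewrite /tri_ser tri_powE // big_add1 big_mkord exprS mulN1r scaleNr; congr (- _).
rewrite scaler_sumr; apply: eq_bigr => i _ /=; have le_in := ltn_ord i.
rewrite subSS subn2 subn1 /= subSn // -scalerMnr; congr (_ *+ _).
rewrite /rb_tri linearZ /comm_br -!scalerAl -!scalerAr !scalerA.
by rewrite -!exprD subnK // subnKC // -scalerBr.
Qed.

Variable x : U.
Hypothesis R1 : R 1 = 1.
Hypothesis star_x : forall i, rb_star (tri_ser x i).
Let X := tri_ser x.
Let A := R \o X.
Variables F E : nat -> U.
Hypotheses (F0 : F 0%N = 1) (FS : forall n, F n.+1 = hconv *%R F A n).
Hypotheses (E0 : E 0%N = 1) (ES : forall n, E n.+1 = - hconv *%R A E n).

Local Notation "f ** g" := (hconv *%R f g) (at level 40, left associativity).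
Let e n := x ^+ n.
Let M := e ** F.

Lemma hmul_FX n : (F ** X) n = x * F n.
Proof.
have X0 : X 0%N = x by rewrite /X /tri_ser expr0 scale1r.
move: n; apply: (@linear_ode_uniq _ A (fun=> 0)) => [|n|n].
- by rewrite hconv0 F0 X0 mul1r mulr1.
- rewrite addr0 hconvS (eq_hconv (op' := *%R) (f' := F ** A) (g' := X)) //.
  rewrite [X in _ + X](eq_hconv (op' := *%R) (f' := F)
    (g' := fun i => (X ** A) i + - (A ** X) i)) //; last first.
    by move=> i _; rewrite /X tri_serS hconv_comm_br opprB.
  by rewrite hmulDr hmulNr !hmulA addrC subrK.
by rewrite addr0 FS hmulMl.
Qed.

Lemma exp_mul_odeS n : M n.+1 = (M ** (fun i => X i + A i)) n.
Proof.
rewrite /M hconvS hmulDr -!hmulA; congr (_ + _); last exact: eq_hconv.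
rewrite (eq_hconv (op' := *%R) (f' := fun i => e i * x) (g' := F)) //; last first.
  by move=> i _; rewrite /e exprSr.
by rewrite hmulMm; apply: eq_hconv => // i _; rewrite hmul_FX.
Qed.

Lemma rb_ode_mul n u : F n * R u = R (sandwich M E u n).
Proof.
elim/ltn_ind: n u => -[|n] IHn u.
  by rewrite F0 /sandwich /M !hconv0 F0 E0 /e expr0 !mul1r mulr1.
rewrite FS (sandwichS _ _ exp_mul_odeS ES) hconvC mulr_suml raddf_sum.
apply: eq_bigr => j _; rewrite raddfMn /= mulrnAl -IHn; last first.
  by rewrite ltnS leq_subr.
rewrite -mulrA star_x mulrDl /comm_br; congr (_ * R _ *+ _).
by rewrite addrA.
Qed.

Lemma rb_ode_exp n : F n = R (x ^+ n).
Proof.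
rewrite -[F n]mulr1 -{1}R1 rb_ode_mul sandwichE.
rewrite (eq_hconv (op' := *%R) (f' := M) (g' := E)) //; last first.
  by move=> i _; rewrite mul1r.
rewrite /M -hmulA (eq_hconv (op' := *%R) (f' := e)
  (g' := fun i => (i == 0)%:R)) ?hmuls1 // => i _.
exact: (ode_invr F0 FS E0 ES).
Qed.

Lemma rb_star_pchar p : p \in [pchar k] -> rb_star (x ^+ p).
Proof.
move=> hp u; have pr_p := pcharf_prime hp.
have Up (v : U) : v *+ p = 0 by rewrite -scaler_nat pcharf0 ?scale0r.
have EF : E p = - F p.
  apply/eqP; rewrite -addr_eq0; apply/eqP.
  have := ode_invr F0 FS E0 ES p.
  by rewrite hconv_pchar // F0 E0 mul1r mulr1 (gtn_eqF (prime_gt0 pr_p)).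
rewrite -rb_ode_exp rb_ode_mul sandwichE /M -hmulA hconv_pchar //.
rewrite [X in e 0%N * X]hconv_pchar // hconv0 F0 E0 /e expr0 mulr1 !mul1r EF.
rewrite mulrN /comm_br.
by rewrite addrC [- _ + _]addrC.
Qed.

End RotaBaxterSeries.

Section Span.
Variables (k : fieldType) (V : lmodType k) (S : V -> Prop).

Lemma in_span_gen v : S v -> in_span S v.
Proof.
by move=> Sv; exists 1%N, (fun=> 1), (fun=> v); split=> //; rewrite big_ord1 scale1r.
Qed.

Lemma in_span0 : in_span S 0.
Proof. by exists 0%N, (fun=> 0), (fun=> 0); split=> [[]|] //; rewrite big_ord0. Qed.

Lemma in_spanZ c v : in_span S v -> in_span S (c *: v).
Proof.
move=> [n [d [w [Sw ->]]]]; exists n, (fun i => c * d i), w; split=> //.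
by rewrite scaler_sumr; apply: eq_bigr => i _; rewrite scalerA.
Qed.

Lemma in_spanD u v : in_span S u -> in_span S v -> in_span S (u + v).
Proof.
move=> [n [c [w [Sw ->]]]] [m [d [t [St ->]]]].
exists (n + m)%N, (fun i => match split i with inl j => c j | inr j => d j end).
exists (fun i => match split i with inl j => w j | inr j => t j end).
split=> [i|]; first by case: split.
rewrite big_split_ord; congr (_ + _); apply: eq_bigr => i _.
  by rewrite (unsplitK (inl i)).
by rewrite (unsplitK (inr i)).
Qed.

Lemma in_spanMn u n : in_span S u -> in_span S (u *+ n).
Proof. by rewrite -scaler_nat; exact: in_spanZ. Qed.

Lemma in_span_sum (I : Type) (r : seq I) (P : pred I) (f : I -> V) :
  (forall i, P i -> in_span S (f i)) -> in_span S (\sum_(i <- r | P i) f i).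
Proof. by move=> Sf; elim/big_ind: _ => //; [exact: in_span0|exact: in_spanD]. Qed.

Lemma in_span_ind (P : V -> Prop) :
  P 0 -> (forall c v u, S v -> in_span S u -> P u -> P (c *: v + u)) ->
  forall u, in_span S u -> P u.
Proof.
move=> P0 PD u [n [c [v [Sv ->]]]].
elim: n c v Sv => [|n IHn] c v Sv; first by rewrite big_ord0.
rewrite big_ord_recl; apply: PD => //; last by apply: IHn => i; exact: Sv.
by apply: in_span_sum => i _; apply/in_spanZ/in_span_gen.
Qed.

End Span.

Section CommBr.
Variables (k : fieldType) (U : algType k).
Implicit Types (a u v w y : U).

Local Notation "f ** g" := (hconv *%R f g) (at level 40, left associativity).

Lemma comm_br_sym u v : comm_br u v = - comm_br v u.
Proof. by rewrite /comm_br opprB. Qed.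

Lemma comm_brDZl (c : k) u v w :
  comm_br (c *: u + v) w = c *: comm_br u w + comm_br v w.
Proof.
rewrite /comm_br mulrDl mulrDr -scalerAl -scalerAr scalerBr.
by rewrite opprD addrACA.
Qed.

Lemma comm_br0l u : comm_br 0 u = 0.
Proof. by rewrite /comm_br mul0r mulr0 subrr. Qed.

Lemma sandwich_exp a y n :
  sandwich (GRing.exp a) (GRing.exp (- a)) y n = iter n (@comm_br U a) y.
Proof.
elim: n => [|n IHn]; first by rewrite /sandwich hconv0 !expr0 mul1r mulr1.
rewrite iterS -IHn /sandwich hconvS /comm_br mulr_sumr mulr_suml -sumrN.
congr (_ + _); apply: eq_bigr => i _.
  by rewrite exprS -!mulrA mulrnAr.
by rewrite exprSr mulrA mulrN mulNrn mulrnAl.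
Qed.

Lemma exp_hmul_ad u v n :
  (GRing.exp (- v) ** (fun j => iter j (@comm_br U v) u)) n = u * (- v) ^+ n.
Proof.
elim: n => [|n IHn]; first by rewrite hconv0 expr0 mul1r mulr1.
rewrite hconvS (eq_hconv (op' := *%R) (f' := fun i => (- v) ^+ i * (- v))
  (g' := fun j => iter j (@comm_br U v) u)) //; last by move=> i _; rewrite exprSr.
rewrite [X in _ + X](eq_hconv (op' := *%R) (f' := GRing.exp (- v))
  (g' := fun j => - (- v * iter j (@comm_br U v) u)
                  + iter j (@comm_br U v) u * (- v))) //; last first.
  by move=> i _; rewrite iterS /comm_br mulNr opprK mulrN.
rewrite hmulDr hmulNr hmulMm.
by rewrite addNKr hmulMr IHn exprSr mulrA.
Qed.

Lemma exp_addS u v n (F := GRing.exp (u + v) ** GRing.exp (- v)) :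
  F n.+1 = (F ** (fun j => iter j (@comm_br U v) u)) n.
Proof.
rewrite /F hconvS -hmulA.
rewrite (eq_hconv (op' := *%R) (f' := fun i => (u + v) ^+ i * (u + v))
  (g' := GRing.exp (- v))) //; last by move=> i _; rewrite exprSr.
rewrite hmulMm -hmulDr; apply: eq_hconv => // i _.
by rewrite exp_hmul_ad exprS mulNr mulrDl addrK.
Qed.

Variables (p : nat) (hp : p \in [pchar k]).
Let pr_p : prime p := pcharf_prime hp.

Lemma pchar_mulrn (v : U) : v *+ p = 0.
Proof. by rewrite -scaler_nat pcharf0 ?scale0r. Qed.

Lemma exprN_pchar a : (- a) ^+ p = - a ^+ p.
Proof.
have hpU : p \in [pchar U] by rewrite pchar_lalg.
by rewrite -!(pFrobenius_autE hpU) pFrobenius_autN.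
Qed.

Lemma comm_br_expp a y : comm_br (a ^+ p) y = iter p (@comm_br U a) y.
Proof.
rewrite -sandwich_exp /sandwich hconv_pchar //; last exact: pchar_mulrn.
by rewrite !expr0 mul1r mulr1 /comm_br addrC exprN_pchar mulrN.
Qed.

(* Jacobson's formula, from the product [exp (s (u + v)) exp (- s v)]. *)
Lemma jacobson u v :
  (u + v) ^+ p - v ^+ p = u ^+ p + \sum_(1 <= r < p) ((r%:R)^-1 : k) *:
    comp_sum p p r (fun s => right_br [seq iter i.-1 (@comm_br U v) u | i <- s]).
Proof.
rewrite -(pchar_ode_dynkin (a := fun j => iter j (@comm_br U v) u) hp _ (exp_addS u v)).
  rewrite hconv_pchar //; last exact: pchar_mulrn.
  by rewrite !expr0 mul1r mulr1 addrC exprN_pchar.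
by rewrite hconv0 !expr0 mulr1.
Qed.
End CommBr.

Section RestrictedRotaBaxter.
Variables (p : nat) (k : fieldType) (hp : p \in [pchar k]).
Variables (g : lieAlgType k) (U : algType k) (iota : {linear g -> U}).
Hypothesis iotaM : lie_to_assoc iota.
Variables (R : {linear g -> g}) (RU : {linear U -> U}).
Hypothesis hRU : rb_extension iota R RU.
Implicit Types u v w x y : U.

Let gp := in_gp p iota.
Let img u := exists a, u = iota a.

Lemma img_gp u : img u -> gp u.
Proof. by case=> a ->; apply: in_span_gen; exists a, 0%N; rewrite expn0 expr1. Qed.

Lemma imgDZ c u v : img u -> img v -> img (c *: u + v).
Proof. by move=> [a ->] [b ->]; exists (c *: a + b); rewrite linearP. Qed.

Lemma img0 : img 0.
Proof. by exists 0; rewrite linear0. Qed.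

Lemma imgN u : img u -> img (- u).
Proof. by move=> u_img; rewrite -[- u]addr0 -scaleN1r; apply/imgDZ/img0. Qed.

Lemma gp_comm_img u w : gp u -> img w -> img (comm_br u w).
Proof.
move=> gp_u [b ->]; elim/in_span_ind: u / gp_u b => [|c v u [a [n ->]] _ IHu] b.
  by rewrite comm_br0l; exact: img0.
rewrite comm_brDZl; apply: imgDZ (IHu b).
elim: n b => [|n IHn] b.
  by rewrite expn0 expr1 -iotaM; eexists.
rewrite expnSr exprM comm_br_expp //.
suff it m : img (iter m (@comm_br U (iota a ^+ (p ^ n))) (iota b)) by exact: it.
elim: m => [|m [b' IHm]]; first by eexists.
by rewrite iterS IHm; exact: IHn.
Qed.

Lemma gp_comm u v : gp u -> gp v -> img (comm_br u v).
Proof.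
move=> gp_u gp_v; rewrite comm_br_sym; apply: imgN.
elim/in_span_ind: v / gp_v => [|c v w [a [n ->]] _ IHw].
  by rewrite comm_br0l; exact: img0.
rewrite comm_brDZl; apply: imgDZ IHw.
have gp_a m : gp (iota a ^+ (p ^ m)) by apply: in_span_gen; exists a, m.
elim: n => [|n IHn].
  by rewrite comm_br_sym; apply/imgN/gp_comm_img; rewrite // expn0 expr1; eexists.
rewrite expnSr exprM comm_br_expp //.
suff it m : img (iter m.+1 (@comm_br U (iota a ^+ (p ^ n))) u).
  by have := it p.-1; rewrite prednK // (prime_gt0 (pcharf_prime hp)).
elim: m => [|m IHm] //.
by rewrite iterS; exact: gp_comm_img.
Qed.

Lemma gp_right_br (T : eqType) (f : T -> U) s :
  (forall i, gp (f i)) -> gp (right_br [seq f i | i <- s]).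
Proof.
move=> gp_f; elim: s => [|i [|j s] IHs] //=; first exact: in_span0.
by apply/img_gp/gp_comm.
Qed.

Lemma gp_comp_sum n r (f : nat -> U) :
  (forall i, gp (f i)) ->
  gp (comp_sum p n r (fun s => right_br [seq f i.-1 | i <- s])).
Proof.
move=> gp_f; apply: in_span_sum => a _; apply/in_spanMn.
by apply: (gp_right_br (f := fun i => f i.-1)) => i.
Qed.

Lemma gp_expp u : gp u -> gp (u ^+ p).
Proof.
elim/in_span_ind: u / => [|c _ u [a [n ->]] gp_u IHu].
  rewrite expr0n; case: eqP => [p0|_]; last exact: in_span0.
  by have := pcharf_prime hp; rewrite p0.
set v := iota a ^+ _.
have gp_v : gp v by apply: in_span_gen; exists a, n.
have := jacobson hp (c *: v) u; move/(canRL (subrK _)) => ->.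
apply: in_spanD IHu; apply: in_spanD.
  rewrite exprZn; apply: in_spanZ; rewrite /v -exprM -expnSr.
  by apply: in_span_gen; exists a, n.+1.
apply: in_span_sum => r _; apply/in_spanZ/gp_comp_sum => i.
elim: i => [|i IHi]; first exact: in_spanZ.
by apply/img_gp/gp_comm.
Qed.

Lemma rb_star_img u : img u -> rb_star RU u.
Proof.
by case: hRU => RUi _ RUM [a ->] w; rewrite linearD RUM subrK.
Qed.

Lemma gp_RU_img u : img u -> gp (RU u).
Proof. by case: hRU => RUi _ _ [a ->]; rewrite RUi; apply: img_gp; eexists. Qed.

Lemma tri_ser_gp x n :
  gp x -> gp (RU x) -> rb_star RU x ->
  [/\ gp (tri_ser RU x n), gp (RU (tri_ser RU x n)) & rb_star RU (tri_ser RU x n)].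
Proof.
move=> gp_x gp_Rx star_x; elim/ltn_ind: n => -[|n] IHn.
  by rewrite /tri_ser expr0 scale1r.
suff s_img : img (tri_ser RU x n.+1).
  by split; [exact: img_gp|exact: gp_RU_img|exact: rb_star_img].
rewrite tri_serS; apply: imgN; apply: (big_ind img) => [|u v u_img v_img|i _].
- exact: img0.
- by rewrite -[u]scale1r; exact: imgDZ.
rewrite -scaler_nat -[_ *: _]addr0; apply: imgDZ img0.
apply: gp_comm; first by case: (IHn i (ltn_ord i)).
by case: (IHn (n - i)%N _) => //; rewrite ltnS leq_subr.
Qed.

Lemma rb_pchar x :
  (forall i, rb_star RU (tri_ser RU x i)) ->
  rb_star RU (x ^+ p) /\
  RU (x ^+ p) = RU x ^+ p + \sum_(1 <= r < p) ((r%:R)^-1 : k) *: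
    comp_sum p p r (fun s => right_br [seq RU (tri_ser RU x i.-1) | i <- s]).
Proof.
case: hRU => _ RU1 _ star_x.
have [F F0 FS] := hconv_exists *%R (1 : U) (RU \o tri_ser RU x).
have [E E0 ES] := left_ode_exists (RU \o tri_ser RU x).
split; first exact: (rb_star_pchar RU1 star_x F0 FS E0 ES).
rewrite -(rb_ode_exp RU1 star_x F0 FS E0 ES) (pchar_ode_dynkin hp F0 FS) /=.
by rewrite /tri_ser expr0 scale1r.
Qed.

Lemma gp_star x : gp x -> gp (RU x) /\ rb_star RU x.
Proof.
elim/in_span_ind: x / => [|c v u [a [n ->]] _ [gp_Ru star_u]].
  split; first by rewrite linear0; exact: in_span0.
  by move=> u; rewrite linear0 comm_br0l mul0r addr0 mul0r linear0.
have gp_a m : gp (iota a ^+ (p ^ m)) by apply: in_span_gen; exists a, m.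
have [gp_Ra star_a] : gp (RU (iota a ^+ (p ^ n))) /\ rb_star RU (iota a ^+ (p ^ n)).
  elim: n => [|n [gp_Ra star_a]].
    rewrite expn0 expr1; split; first by apply: gp_RU_img; eexists.
    by apply: rb_star_img; eexists.
  have ser := tri_ser_gp _ (gp_a n) gp_Ra star_a.
  have [|star_ap RU_ap] := @rb_pchar (iota a ^+ (p ^ n)).
    by move=> i; case: (ser i).
  rewrite expnSr exprM; split=> //; rewrite RU_ap; apply: in_spanD.
    exact: gp_expp.
  apply: in_span_sum => r _; apply/in_spanZ.
  by apply: (@gp_comp_sum _ _ (fun i => RU (tri_ser RU _ i))) => i; case: (ser i).
split; first by rewrite linearP; apply: in_spanD gp_Ru; exact: in_spanZ.
move=> w; rewrite linearP mulrDl -scalerAl star_a star_u comm_brDZl -linearP.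
by rewrite mulrDl -scalerAl scalerDr addrACA.
Qed.

End RestrictedRotaBaxter.

Lemma right_br_signs (k : fieldType) (U : algType k) (f : nat -> U) (s : seq nat) :
  all (fun m => 0 < m)%N s ->
  right_br [seq (-1) ^+ i.-1 *: f i | i <- s] =
    (-1) ^+ (sumn s - size s) *: right_br [seq f i | i <- s].
Proof.
have sum_ge (t : seq nat) : all (fun m => 0 < m)%N t -> (size t <= sumn t)%N.
  by elim: t => //= m t IHt /andP[m_gt0 /IHt]; rewrite -add1n; exact: leq_add.
elim: s => [|i [|j s] IHs] //=; first by rewrite scaler0.
  by move=> _; rewrite addn0 subn1.
move=> /andP[i_gt0 s_gt0]; have := IHs s_gt0; rewrite /= => ->.
have -> : (i + (j + sumn s) - (size s).+2 = i.-1 + (j + sumn s - (size s).+1))%N.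
  by rewrite addnBA ?(sum_ge (j :: s)) // -{1}(prednK i_gt0).
rewrite exprD -scalerA /comm_br !scalerBr -!scalerAl -!scalerAr !scalerA.
by rewrite [X in _ - X *: _ = _]mulrC.
Qed.

Theorem proposition4p19 (p : nat) (k : closedFieldType) (hp : p \in [pchar k])
  (g : lieAlgType k) (R : {linear g -> g}) (hR : rota_baxter1 R)
  (U : algType k) (iota : {linear g -> U}) (hU : enveloping_algebra iota)
  (RU : {linear U -> U}) (hRU : rb_extension iota R RU)
  (x : U) (hx : in_gp p iota x) :
  RU (x ^+ p) = RU x ^+ p +
    \sum_(1 <= r < p) ((-1) ^+ (p - r) * (r%:R)^-1 : k) *:
      \sum_(a : r.-tuple 'I_p.+1 | is_composition p (map val a))
        right_br [seq RU (tri_pow (rb_tri RU) x (val i)) | i <- a]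
          *+ comp_coef (map val a).
Proof.
have [gp_Rx star_x] := gp_star hp hU.1 hRU hx.
have [|_ ->] := rb_pchar hp hRU (x := x).
  by move=> i; case: (tri_ser_gp hp hU.1 hRU i hx gp_Rx star_x).
congr (_ + _); apply: eq_bigr => r _.
rewrite mulrC -scalerA; congr (_ *: _).
rewrite scaler_sumr; apply: eq_bigr => a /andP[a_gt0 /eqP sum_a].
rewrite -scalerMnr; congr (_ *+ _).
have -> : [seq RU (tri_ser RU x i.-1) | i <- map val a] =
    [seq (-1) ^+ i.-1 *: RU (tri_pow (rb_tri RU) x i) | i <- map val a].
  apply/eq_in_map => i a_i; have i_gt0 := allP a_gt0 i a_i.
  by rewrite /tri_ser linearZ prednK.
by rewrite right_br_signs // sum_a size_map size_tuple -map_comp.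
Qed.
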